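(* Let $k\ge 2$ be a fixed integer. The property of a graph $G$ being a $k$-leaf power can be expressed as an $\mathrm{MSO}_2$ formula of $G\boxtimes C_k$ and of the set of horizontal edges of this graph product. That is, there is an $\mathrm{MSO}_2$ formula $\varphi_k(H)$ with one free edge-set variable $H$ such that a graph $G$ is a $k$-leaf power if and only if $\varphi_k$ is true in the graph $G\boxtimes C_k$ when $H$ is interpreted as the set of horizontal edges of $G\boxtimes C_k$.
   Context: Graphs are finite, simple and undirected. For a tree $T$, the $k$th leaf power of $T$ is the graph whose vertices are the leaves of $T$ and in which two distinct leaves are adjacent if and only if they are connected by a path of at most $k$ edges in $T$. $G$ is a $k$-leaf power if it is (up to identification of the vertices of $G$ with the leaves of $T$) the $k$th leaf power of some tree $T$. $C_k$ denotes the $k$-vertex cycle graph (for $k=2$, read as a single edge on two vertices). The strong product $G_1\boxtimes G_2$ has as vertices the ordered pairs of a vertex of $G_1$ and a vertex of $G_2$; two distinct vertices $(u_1,u_2)$ and $(v_1,v_2)$ are adjacent if and only if for each $i\in\{1,2\}$, $u_i=v_i$ or $u_i$ and $v_i$ are adjacent in $G_i$. An edge of $G_1\boxtimes G_2$ from $(u_1,u_2)$ to $(v_1,v_2)$ is horizontal if $u_1=v_1$. $\mathrm{MSO}_2$ is the monadic second-order logic of graphs with variables for vertices, edges, sets of vertices and sets of edges (of the graph to which the formula is applied), quantification over all of these, and the predicates of equality, set membership, and incidence between an edge and a vertex. *)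

(* Defs.v *)
From mathcomp Require Import all_boot.

Set Implicit Arguments.
Unset Strict Implicit.
Unset Printing Implicit Defensive.

Record sgraph := SGraph {
  vertex :> finType;
  adj : rel vertex;
  adj_sym : symmetric adj;
  adj_irr : irreflexive adj }.

Definition edges (G : sgraph) : {set {set G}} :=
  [set [set p.1; p.2] | p : G * G & adj p.1 p.2].

Definition edge (G : sgraph) : finType := {e : {set G} | e \in edges G}.

Definition isomorphic (G1 G2 : sgraph) : Prop :=
  exists2 f : G1 -> G2,
    bijective f & forall x y, adj (f x) (f y) = adj x y.

Definition is_tree (T : sgraph) : Prop :=
  [/\ 0 < #|T|,
      forall x y : T, connect (@adj T) x y &
      forall c : seq T, 2 < size c -> ~ ucycle (@adj T) c].

(** A vertex of degree at most one: the bound rather than an equality only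
    matters for the one-vertex tree, whose vertex is a leaf, so that the
    one-vertex graph is a leaf power like all other edgeless graphs. *)
Definition is_leaf (T : sgraph) (x : T) : bool := #|[set y | adj x y]| <= 1.

Definition path_within (G : sgraph) (k : nat) (x y : G) : bool :=
  [exists n : 'I_k.+1, exists p : n.-tuple G,
    [&& path (@adj G) x p, last x p == y & uniq (x :: p)]].

Section LeafPower.
Variables (k : nat) (T : sgraph).

Definition leaf : finType := {x : T | is_leaf x}.

Definition leaf_adj : rel leaf :=
  fun x y => (x != y) && path_within k (val x) (val y).

Lemma path_within_sym : symmetric (@path_within T k).
Proof.
suff imp (x y : T) : path_within k x y -> path_within k y x.
  by move=> x y; apply/idP/idP; apply: imp.
rewrite /path_within => /existsP[n /existsP[p /and3P[xp /eqP<- up]]].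
have sz : size (rev (belast x p)) == n.
  by rewrite size_rev size_belast size_tuple.
apply/existsP; exists n; apply/existsP; exists (Tuple sz).
have eqr : last x p :: rev (belast x p) = rev (x :: p).
  by rewrite [x :: p]lastI rev_rcons.
rewrite -[tval (Tuple sz)]/(rev (belast x p)) eqr rev_uniq up andbT rev_path.
rewrite (eq_path (e' := @adj T)) ?xp => [|u v]; last by rewrite adj_sym.
by rewrite -(last_cons x (last x p)) eqr rev_cons last_rcons eqxx.
Qed.

Lemma leaf_adj_sym : symmetric leaf_adj.
Proof. by move=> x y; rewrite /leaf_adj eq_sym path_within_sym. Qed.

Lemma leaf_adj_irr : irreflexive leaf_adj.
Proof. by move=> x; rewrite /leaf_adj eqxx. Qed.

Definition leaf_power : sgraph := SGraph leaf_adj_sym leaf_adj_irr.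

End LeafPower.

Definition is_leaf_power (k : nat) (G : sgraph) : Prop :=
  exists T : sgraph, is_tree T /\ isomorphic G (leaf_power k T).

Section Cycle.
Variable k : nat.

Definition cycle_adj : rel 'I_k :=
  fun i j => (i != j) && ((j == ordS i) || (i == ordS j)).

Lemma cycle_adj_sym : symmetric cycle_adj.
Proof. by move=> i j; rewrite /cycle_adj eq_sym orbC. Qed.

Lemma cycle_adj_irr : irreflexive cycle_adj.
Proof. by move=> i; rewrite /cycle_adj eqxx. Qed.

Definition cycle_graph : sgraph := SGraph cycle_adj_sym cycle_adj_irr.

End Cycle.

Section StrongProduct.
Variables G1 G2 : sgraph.

Definition strong_adj : rel (G1 * G2) :=
  fun u v => [&& u != v, (u.1 == v.1) || adj u.1 v.1
                       & (u.2 == v.2) || adj u.2 v.2].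

Lemma strong_adj_sym : symmetric strong_adj.
Proof.
move=> u v; rewrite /strong_adj [u == v]eq_sym [u.1 == _]eq_sym.
by rewrite [u.2 == _]eq_sym (adj_sym u.1) (adj_sym u.2).
Qed.

Lemma strong_adj_irr : irreflexive strong_adj.
Proof. by move=> u; rewrite /strong_adj eqxx. Qed.

Definition strong_product : sgraph := SGraph strong_adj_sym strong_adj_irr.

Definition horizontal_edges : {set edge strong_product} :=
  [set e | [exists u : strong_product, exists v : strong_product,
    (val e == [set u; v]) && (u.1 == v.1)]].

End StrongProduct.

(** MSO2 formulas are intrinsically scoped and sorted: [mso2 Gamma] is the
    type of formulas whose free variables are those of the context [Gamma],
    a list of sorts, and a variable is a de Bruijn index into it. Hence no
    default value is needed to interpret formulas in graphs without vertices
    or without edges. *)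
Inductive mso_sort := Vertex | Edge | VertexSet | EdgeSet.

Inductive var : seq mso_sort -> mso_sort -> Type :=
| Var0 Gamma s : var (s :: Gamma) s
| VarS Gamma s t : var Gamma s -> var (t :: Gamma) s.

Inductive mso2 (Gamma : seq mso_sort) : Type :=
| Equal s (x y : var Gamma s)
| MemV (x : var Gamma Vertex) (X : var Gamma VertexSet)
| MemE (e : var Gamma Edge) (F : var Gamma EdgeSet)
| Inc (e : var Gamma Edge) (x : var Gamma Vertex)
| Not (f : mso2 Gamma)
| And (f g : mso2 Gamma)
| Or (f g : mso2 Gamma)
| Imp (f g : mso2 Gamma)
| Exists s (f : mso2 (s :: Gamma))
| Forall s (f : mso2 (s :: Gamma)).

Definition dom (G : sgraph) (s : mso_sort) : Type :=
  match s with
  | Vertex => G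
  | Edge => edge G
  | VertexSet => {set G}
  | EdgeSet => {set edge G}
  end.

Fixpoint env (G : sgraph) (Gamma : seq mso_sort) : Type :=
  if Gamma is s :: Gamma' then (dom G s * env G Gamma')%type else unit.

Fixpoint lookup (G : sgraph) Gamma s (x : var Gamma s) :
    env G Gamma -> dom G s :=
  match x with
  | Var0 _ _ => fun rho => rho.1
  | VarS _ _ _ y => fun rho => lookup y rho.2
  end.

Fixpoint sat (G : sgraph) Gamma (f : mso2 Gamma) : env G Gamma -> Prop :=
  match f with
  | Equal _ x y => fun rho => lookup x rho = lookup y rho
  | MemV x X => fun rho => (lookup x rho : G) \in (lookup X rho : {set G})
  | MemE e F =>
      fun rho => (lookup e rho : edge G) \in (lookup F rho : {set edge G})
  | Inc e x => fun rho => (lookup x rho : G) \in val (lookup e rho : edge G)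
  | Not f => fun rho => ~ sat f rho
  | And f g => fun rho => sat f rho /\ sat g rho
  | Or f g => fun rho => sat f rho \/ sat g rho
  | Imp f g => fun rho => sat f rho -> sat g rho
  | Exists s f => fun rho => exists a : dom G s, @sat G (s :: _) f (a, rho)
  | Forall s f => fun rho => forall a : dom G s, @sat G (s :: _) f (a, rho)
  end.

(* Main.v *)
(** Let T be a rooted tree whose k-th leaf power is G. For a vertex s of T,
    split s into one copy for each connected component C of the subgraph of G
    induced by the leaves below s. Adjacent leaves are already merged at their
    lowest common ancestor, so distances of at most k between leaves do not
    change, and the other distances do not decrease. Represent a copy (s, C) in
    the strong product of G and C_k by (a, depth of s mod k), where a is the
    leaf of C closest to the root. If the representatives a and a' of (s, C) and
    of its parent differ, then a' lies outside C, some edge of G leaves C below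
    the parent of s, and the path from a to a' is no longer than the path
    between the ends of that edge, so that a and a' are adjacent in G. Copies at
    least k - 1 above their representative need no parent edge to certify an
    adjacency of G; dropping these edges lets the depth mod k identify s. Hence
    the product contains a rooted forest with one leaf in each fiber whose
    distances of at most k encode G. Conversely every such forest gives a tree
    whose k-th leaf power is G, and the existence of the forest is expressible
    in MSO_2: guess its edges, its leaves, and its depths modulo 3, which orient
    the edges. *)

Require Import Defs.
From mathcomp Require Import all_boot zify.

Set Implicit Arguments.
Unset Strict Implicit.
Unset Printing Implicit Defensive.

(** * Rooted trees and forests *)

Definition rooted (S : Type) (par : S -> S) (r : S) : Prop :=
  par r = r /\ forall x, exists n, iter n par x = r.

(* When par is the parent function of a rooted tree, this says that x and y are
   at distance at most k; the root is its own parent. *)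
Definition meet_within (S : Type) (par : S -> S) (k : nat) (x y : S) : Prop :=
  exists i j, i + j <= k /\ iter i par x = iter j par y.

Definition depth_function (S : eqType) (par : S -> S) (r : S)
    (dep : S -> nat) : Prop :=
  dep r = 0 /\ forall x, x != r -> dep x = (dep (par x)).+1.

Section RootedGraph.
Variables (S : finType) (par : S -> S).

Definition rooted_adj : rel S :=
  fun x y => (x != y) && ((y == par x) || (x == par y)).

Lemma rooted_adj_sym : symmetric rooted_adj.
Proof. by move=> x y; rewrite /rooted_adj eq_sym orbC. Qed.

Lemma rooted_adj_irr : irreflexive rooted_adj.
Proof. by move=> x; rewrite /rooted_adj eqxx. Qed.

Definition rooted_graph : sgraph := SGraph rooted_adj_sym rooted_adj_irr.

Lemma iter_connect n x : connect rooted_adj x (iter n par x).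
Proof.
elim: n => [|n IH] /=; first exact: connect0.
set y := iter n par x in IH *; have [<-//|ypy] := eqVneq y (par y).
by apply: connect_trans IH (connect1 _); rewrite /rooted_adj ypy eqxx.
Qed.

(** Prepending an edge to a path keeps a meeting point: a step up adds one to i, and a step down
    takes one from i or, if i is zero, adds one to j. Conversely, the two ascents to the meeting
    point form a walk, which is shortened to a simple path. *)
Lemma path_withinP k (x y : S) :
  reflect (meet_within par k x y) (@path_within rooted_graph k x y).
Proof.
apply: (iffP idP) => [|[i [j [le_k itE]]]].
  case/existsP=> n /existsP[p /and3P[xp /eqP<- _]].
  suff [i [j [le_n itE]]] : meet_within par (size p) x (last x p).
    exists i, j; split=> //; apply: leq_trans le_n _.
    by rewrite size_tuple -ltnS.
  move: (tval p) xp => {n y}p; elim: p x => [|z p IH] x /=;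
    first by exists 0, 0.
  case/andP=> /andP[_ xz] /IH[i [j [le_p itE]]].
  case/orP: xz => /eqP zE; last first.
    case: i le_p itE => [|i] le_p itE.
      by exists 0, j.+1; split; [exact: le_p | rewrite /= -itE].
    by exists i, j; split; [exact/leqW/ltnW | rewrite -itE iterSr -zE].
  by exists i.+1, j; split; [exact: le_p | rewrite iterSr -zE].
have walk i1 (u : S) : exists2 p, path rooted_adj u p &
    last u p = iter i1 par u /\ size p <= i1.
  elim: i1 => [|i1 [p up [pl szp]]]; first by exists [::].
  have [fx|nfx] := eqVneq (iter i1 par u) (par (iter i1 par u)).
    by exists p; rewrite //= -fx; split=> //; apply: leqW.
  exists (rcons p (iter i1.+1 par u)); last by rewrite last_rcons size_rcons.
  by rewrite rcons_path up pl /= /rooted_adj nfx eqxx.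
have [p xp [pl szp]] := walk i x; have [q yq [ql szq]] := walk j y.
have : exists2 p0, path rooted_adj x p0 & last x p0 = y /\ size p0 <= k.
  exists (p ++ rev (belast y q)); last first.
    split; last by rewrite size_cat size_rev size_belast; lia.
    rewrite last_cat pl itE -ql.
    by case: (q) => //= a q'; rewrite rev_cons last_rcons.
  rewrite cat_path xp pl itE -ql rev_path /=.
  by under eq_path do rewrite rooted_adj_sym.
case=> p0 xp0 []; case/shortenP: xp0 => p1 xp1 up1 sub <- szp0.
have szp1 : size p1 < k.+1.
  by apply: leq_trans szp0; apply: uniq_leq_size sub; case/andP: up1.
apply/existsP; exists (Ordinal szp1); apply/existsP; exists (in_tuple p1).
exact/and3P.
Qed.

End RootedGraph.

Section Rooted.
Variables (S : finType) (par : S -> S) (r : S).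
Hypothesis rootS : rooted par r.

Lemma rooted_depth : exists dep, depth_function par r dep.
Proof.
case: rootS => parr reach.
have reachb x : exists n, iter n par x == r.
  by case: (reach x) => n <-; exists n.
exists (fun x => ex_minn (reachb x)); split.
  by case: ex_minnP => n _ /(_ 0 (eqxx r)); rewrite leqn0 => /eqP->.
move=> x xr; case: ex_minnP => n /eqP itn minn.
case: ex_minnP => m /eqP itm minm.
have /minn le_n : iter m.+1 par x == r by rewrite iterSr itm.
case: n itn minn le_n => [/= xr'|n]; first by rewrite xr' eqxx in xr.
rewrite iterSr => itn minn le_n.
have /minm le_m : iter n par (par x) == r by rewrite itn.
by lia.
Qed.

Variable dep : S -> nat.
Hypothesis depS : depth_function par r dep.

Lemma dep_parE x : dep (par x) = (dep x).-1.
Proof.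
case: rootS depS => parr _ [d0 dS].
by have [->|xr] := eqVneq x r; [rewrite parr d0 | rewrite (dS x xr)].
Qed.

Lemma dep_eq0 x : dep x = 0 -> x = r.
Proof. by have [//|/depS.2->] := eqVneq x r. Qed.

Lemma dep_iter n x : dep (iter n par x) = dep x - n.
Proof. by elim: n => [|n IH]; rewrite ?subn0 //= dep_parE IH subnS. Qed.

(** Iterates stay at the root once they reach it, so the number of steps can be normalized to the
    difference of the depths. *)
Lemma iter_depE n x s :
  iter n par x = s -> dep s <= dep x /\ iter (dep x - dep s) par x = s.
Proof.
move=> itn; have ds : dep s = dep x - n by rewrite -itn dep_iter.
split; first by rewrite ds leq_subr.
have [le_n|/ltnW lt_n] := leqP n (dep x).
  by rewrite ds subKn.
have s0 : dep s = 0 by apply/eqP; rewrite ds subn_eq0.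
rewrite s0 subn0 (dep_eq0 s0); apply: dep_eq0.
by rewrite dep_iter subnn.
Qed.

Lemma par_cycle2 x : par (par x) = x -> x = r.
Proof.
move=> ppx; apply: dep_eq0.
by move: (congr1 dep ppx); rewrite !dep_parE; lia.
Qed.

(** A deepest vertex of a cycle has no child on it, so both its neighbours on the cycle equal its
    parent, against uniqueness. *)
Lemma rooted_graph_tree : is_tree (rooted_graph par).
Proof.
case: rootS => parr reach; split; first by apply/card_gt0P; exists r.
  have toroot (x : S) : connect (rooted_adj par) x r.
    by case: (reach x) => n <-; apply: iter_connect.
  move=> x y; apply: connect_trans (toroot x) _.
  by rewrite (sym_connect_sym (@rooted_adj_sym _ par)).
move=> c szc /andP[cyc unc].
case: c szc cyc unc => // c0 c szc cyc unc.
case: (arg_maxnP (P := [in c0 :: c]) dep (mem_head c0 c)) => x xc maxx.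
have nbr y : y \in c0 :: c -> rooted_adj par x y -> y = par x.
  move=> yc /andP[xy /orP[/eqP//|/eqP xpy]].
  have yr : y != r by apply: contra_neq xy => yr; rewrite xpy yr.
  by have := maxx y yc; rewrite (depS.2 y yr) -xpy /= ltnn.
case: (rot_to xc) => i p rotc.
have mem_rot_p y : y \in x :: p -> y \in c0 :: c by rewrite -rotc mem_rot.
have := size_rot i (c0 :: c); rewrite rotc => szp.
have : uniq (x :: p) by rewrite -rotc rot_uniq.
have : cycle (rooted_adj par) (x :: p) by rewrite -rotc rot_cycle.
rewrite -szp in szc.
case: p szc mem_rot_p {rotc szp} => [//|y p] szc mem_xyp.
case/lastP: p szc mem_xyp => [//|p z] _ mem_xyp.
rewrite /= rcons_path last_rcons => /and3P[xy _ zx] /and3P[_ + _].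
rewrite (nbr y) ?mem_xyp ?inE ?eqxx ?orbT //.
rewrite -(nbr z) ?mem_xyp ?inE ?mem_rcons ?inE ?eqxx ?orbT //.
by rewrite rooted_adj_sym.
Qed.

Lemma rooted_exists_leaf : exists x : rooted_graph par, is_leaf x.
Proof.
case: (arg_maxnP (P := predT) dep (isT : predT r)) => x _ maxx.
exists x; rewrite /is_leaf; apply: (@leq_trans #|[set par x]|);
  last by rewrite cards1.
apply/subset_leq_card/subsetP=> y; rewrite !inE => /andP[xy /orP[//|/eqP xpy]].
have yr : y != r.
  by apply: contra_neq xy => yr; rewrite xpy yr; case: rootS.
by have := maxx y isT; rewrite (depS.2 y yr) -xpy /= ltnn.
Qed.
End Rooted.

Lemma tree_rooting (T : sgraph) (r : T) : is_tree T ->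
  exists2 par : T -> T, rooted par r & @adj T =2 rooted_adj par.
Proof.
case=> _ conn acyc.
pose P x n := [exists p : n.-tuple T, path (@adj T) x p && (last x p == r)].
have exP x : exists n, P x n.
  have /connectP[p xp rE] := conn x r.
  by exists (size p); apply/existsP; exists (in_tuple p); rewrite xp -rE eqxx.
pose d x := ex_minn (exP x).
have step x : x != r -> exists y, adj x y && (d y < d x).
  move=> xr; rewrite {2}/d; case: ex_minnP => n /existsP[p /andP[]] + + _.
  case: p => -[|y p] /= /eqP <-; first by rewrite (negbTE xr).
  move=> /andP[xy yp] lastp; exists y; rewrite xy ltnS /d.
  case: ex_minnP => m _; apply; apply/existsP; exists (in_tuple p).
  by rewrite yp.
(* The default makes r its own parent, since nothing is nearer to r than r itself. *)
pose par x := if [pick y | adj x y && (d y < d x)] is Some y then y else r.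
have par_step x : x != r -> adj x (par x) /\ d (par x) < d x.
  move=> /step[y xy]; rewrite /par; case: pickP => [z /andP[]|/(_ y)] //.
  by rewrite xy.
have d0 : d r = 0.
  rewrite /d; case: ex_minnP => m _ /(_ 0); rewrite leqn0 => m0; apply/eqP/m0.
  by apply/existsP; exists [tuple]; rewrite /= eqxx.
have parr : par r = r.
  by rewrite /par; case: pickP => // y; rewrite d0 ltn0 andbF.
exists par.
  split=> // x; move: {2}(d x) (leqnn (d x)) => n.
  elim: n x => [|n IH] x le_n; have [->|xr] := eqVneq x r; try by exists 0.
    by have [_] := par_step _ xr; rewrite ltnNge (leq_trans le_n).
  have [|m <-] := IH (par x); last by exists m.+1; rewrite iterSr.
  by rewrite -ltnS; apply: leq_trans le_n; case: (par_step _ xr).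
move=> x y; apply/idP/idP; last first.
  case/andP=> xy /orP[/eqP yE|/eqP xE].
    have [xr|/par_step[]] := eqVneq x r; last by rewrite -yE.
    by rewrite yE xr parr eqxx in xy.
  have [yr|/par_step[]] := eqVneq y r; last by rewrite -xE adj_sym.
  by rewrite xE yr parr eqxx in xy.
move=> xy; have nxy : x != y by apply: contraTneq xy => ->; rewrite adj_irr.
rewrite /rooted_adj nxy /=; apply/negPn/negP; rewrite negb_or => /andP[npx npy].
(* The parent edges connect x and y without using the edge xy, which therefore
   lies on a cycle. *)
pose e u v := adj u v && ([set u; v] != [set x; y]).
have e_sym : symmetric e by move=> u v; rewrite /e adj_sym setUC.
have toroot u : connect e u r.
  move: {2}(d u) (leqnn (d u)) => n.
  elim: n u => [|n IH] u le_n; have [->|ur] := eqVneq u r; try exact: connect0.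
    by have [_] := par_step _ ur; rewrite ltnNge (leq_trans le_n).
  have [upar lt_d] := par_step _ ur.
  apply: (@connect_trans _ _ (par u)); last first.
    by apply: IH; rewrite -ltnS; apply: leq_trans le_n.
  apply: connect1; rewrite /e upar; apply/eqP => uE.
  have : u \in [set x; y] by rewrite -uE !inE eqxx.
  have : par u \in [set x; y] by rewrite -uE !inE eqxx orbT.
  have : y \in [set u; par u] by rewrite uE !inE eqxx orbT.
  have : x \in [set u; par u] by rewrite uE !inE eqxx.
  have neq : par u != u by apply: contraTneq lt_d => ->; rewrite ltnn.
  rewrite !inE => xin yin pin /orP[]/eqP uE1; subst u.
    by rewrite eq_sym (negbTE nxy) (negbTE npx) in yin.
  by rewrite (negbTE nxy) (negbTE npy) in xin.
have /connectP[p xp yE] : connect e x y.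
  by apply: connect_trans (toroot x) _; rewrite (sym_connect_sym e_sym).
case/shortenP: xp yE => {}p xp up _ yE.
apply: (acyc (x :: p)); last first.
  rewrite /ucycle up andbT /= rcons_path -yE adj_sym xy andbT.
  by apply: sub_path xp => u v /andP[].
case: p xp {up} yE => [|z [|//]] /=; first by move=> _ yx;
  rewrite yx eqxx in nxy.
by rewrite andbT => + yz; rewrite /e yz eqxx andbF.
Qed.

Lemma tree_path_withinP (T : sgraph) (par : T -> T) (k : nat) (x y : T) :
  @adj T =2 rooted_adj par ->
  reflect (meet_within par k x y) (path_within k x y).
Proof.
move=> adjT;
  suff -> : path_within k x y = @path_within (rooted_graph par) k x y.
  exact (path_withinP par k x y).
apply: eq_existsb => n; apply: eq_existsb => p.
by rewrite (eq_path adjT).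
Qed.

Lemma isomorphicP (G1 G2 : sgraph) (f : G1 -> G2) :
  injective f -> (forall y, exists x, f x = y) ->
  (forall x y, adj (f x) (f y) = adj x y) -> isomorphic G1 G2.
Proof.
move=> injf surjf adjf; exists f => //.
have surjb y : exists x, f x == y by case: (surjf y) => x <-; exists x.
exists (fun y => xchoose (surjb y)) => [x|y];
  last exact/eqP/(xchooseP (surjb y)).
exact/injf/eqP/(xchooseP (surjb (f x))).
Qed.

(* Rooting the tree at one of the marked leaves makes the ancestors of marked
   leaves a subtree that has no other leaf: the root is marked, and every other
   unmarked vertex has both a parent and a child. *)
Lemma leaf_power_prune (k : nat) (G T : sgraph) (p : G -> T) (x0 : G) :
  is_tree T -> injective p -> (forall x, is_leaf (p x)) ->
  (forall x y, adj x y = (x != y) && path_within k (p x) (p y)) ->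
  is_leaf_power k G.
Proof.
move=> treeT injp leafp adjE.
have [par rootT adjT] := tree_rooting (p x0) treeT.
have [dep depS] := rooted_depth rootT; have [parr reach] := rootT.
pose N s := [exists x, fconnect par (p x) s].
have Npar s : N s -> N (par s).
  case/existsP=> x xs; apply/existsP; exists x.
  by apply: connect_trans xs (fconnect1 _ _).
have Np x : N (p x) by apply/existsP; exists x; apply: connect0.
pose S : finType := {s | N s}.
pose q x : S := Sub (p x) (Np x).
pose parS (s : S) : S := Sub (par (val s)) (Npar _ (valP s)).
have iterS n s : val (iter n parS s) = iter n par (val s).
  by elim: n => //= n ->.
have rootS : rooted parS (q x0).
  split; first exact/val_inj.
  by move=> s; have [n itn] := reach (val s); exists n; apply: val_inj;
    rewrite iterS.
have adjS (s t : S) : rooted_adj parS s t = adj (val s) (val t).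
  by rewrite adjT.
have path_withinS (s t : S) :
    @path_within (rooted_graph parS) k s t = path_within k (val s) (val t).
  apply/path_withinP/(tree_path_withinP _ _ _ adjT) => -[i [j [le_k itE]]].
    by exists i, j; split=> //; rewrite -!iterS itE.
  by exists i, j; split=> //; apply: val_inj; rewrite !iterS.
have leafq x : @is_leaf (rooted_graph parS) (q x).
  apply: leq_trans (leafp x); rewrite -(card_imset _ val_inj).
  apply/subset_leq_card/subsetP=> _ /imsetP[s + ->]; rewrite !inE => /=.
  by rewrite adjS.
have leaf_q (s : S) : @is_leaf (rooted_graph parS) s -> exists x, q x = s.
  move=> leafs; have /existsP[x /iter_findex] := valP s.
  case: (findex _ _ _) => [xs|n xs]; first by exists x; apply: val_inj.
  pose t := iter n parS (q x).
  have tE : parS t = s by apply: val_inj; rewrite -xs /= iterS.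
  have [->|sx0] := eqVneq s (q x0); first by exists x0.
  have ds : dep (val s) = (dep (val (parS s))).+1.
    by apply: depS.2; apply: contra_neq sx0 => sx0; apply: val_inj.
  have tx0 : t != q x0.
    by apply: contra_neq sx0 => tx0; rewrite -tE tx0; apply: rootS.1.
  have dt : dep (val t) = (dep (val s)).+1.
    by rewrite -tE; apply: depS.2; apply: contra_neq tx0 => tx0; apply: val_inj.
  have : #|[set t; parS s]| <= 1.
    apply: leq_trans leafs; apply/subset_leq_card/subsetP=> u; rewrite !inE /=.
    have neq (s1 s2 : S) : dep (val s1) != dep (val s2) -> s1 != s2.
      by apply: contra_neq => ->.
    by case/orP=> /eqP->; rewrite /rooted_adj ?tE eqxx ?orbT andbT neq //; lia.
  rewrite cards2; suff -> : t != parS s by [].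
  by apply/eqP => tpar; move: dt; rewrite tpar ds; lia.
exists (rooted_graph parS); split.
  by have [d dS] := rooted_depth rootS; apply: rooted_graph_tree rootS _ dS.
apply: (@isomorphicP _ (leaf_power k (rooted_graph parS))
          (fun x => Sub (q x) (leafq x) : leaf (rooted_graph parS))).
- by move=> x y /(congr1 val)/(congr1 val)/injp.
- move=> s; have [x xs] := leaf_q (val s) (valP s).
  by exists x; apply: val_inj.
- move=> x y; rewrite adjE /= /leaf_adj path_withinS; congr (~~ _ && _).
  by apply/eqP/eqP => [/(congr1 val)/(congr1 val)/injp|->].
Qed.

(** * From forests to trees *)

Section ForestToTree.
Variables (k : nat) (V : finType) (par : V -> V).
Hypothesis wf : forall v, exists n, par (iter n par v) = iter n par v.

(* Below each root of the forest hangs a chain of k further vertices, and the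
   chains meet in the vertex None: different trees of the forest stay more than
   k apart. *)
Definition chain (s : option (V * 'I_k.+1)) : option (V * 'I_k.+1) :=
  if s is Some (v, i) then
    if (i != ord0) || (par v == v) then
      if i < k then Some (v, inord i.+1) else None
    else Some (par v, ord0)
  else None.

Lemma chain_rooted : rooted chain None.
Proof.
have chains v i : (i != ord0) || (par v == v) ->
    exists n, iter n chain (Some (v, i)) = None.
  move: {2}(k - i) (leqnn (k - i)) => m; elim: m i => [|m IH] i le_m vi.
    exists 1; rewrite /= vi.
    by case: ltnP => // lt_k; lia.
  have [lt_k|le_k] := ltnP i k; last first.
    exists 1; rewrite /= vi.
    by rewrite ltnNge le_k.
  have [||n itn] := IH (inord i.+1).
  - by rewrite inordK; lia.
  - by apply/orP; left; rewrite -val_eqE /= inordK.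
  exists n.+1; rewrite iterSr /= vi.
  by rewrite lt_k.
split=> // -[[v i]|]; last by exists 0.
have [|] := boolP ((i != ord0) || (par v == v)); first exact: chains.
rewrite negb_or negbK => /andP[/eqP-> _] {i}.
have [n] := wf v; elim: n v => [|n IH] v pv.
  by apply/chains/orP; right; apply/eqP.
have [vr|vr] := eqVneq (par v) v; first by apply/chains/orP; right; apply/eqP.
have [|m itm] := IH (par v); first by rewrite -iterSr.
by exists m.+1; rewrite iterSr /= (negbTE vr).
Qed.

(** A chain is long enough that k steps from position 0 never reach [None]; the position leaves 0
    only at a root of the forest, where [par] is idle. *)
Lemma iter_chain n v : n <= k ->
  exists m : 'I_k.+1,
    [/\ iter n chain (Some (v, ord0)) = Some (iter n par v, m),
      m <= n & m != ord0 -> par (iter n par v) = iter n par v].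
Proof.
elim: n => [|n IH] le_n; first by exists ord0.
have [m [/= -> le_m rootm]] := IH (ltnW le_n); rewrite /=.
case: ifP => [m_root|_]; last by exists ord0.
have ->: m < k by apply: leq_ltn_trans le_m le_n.
have -> : par (iter n par v) = iter n par v.
  by case/orP: m_root => [/rootm|/eqP].
exists (inord m.+1); split=> //; last first.
  by case/orP: m_root => [/rootm|/eqP].
by rewrite inordK // ltnS (leq_trans _ le_n).
Qed.

Lemma iter_par_chain n v :
  exists2 m, m <= n & iter m chain (Some (v, ord0)) = Some (iter n par v, ord0).
Proof.
elim: n => [|n [m le_m itm]] /=; first by exists 0.
have [->|vr] := eqVneq (par (iter n par v)) (iter n par v).
  by exists m => //; apply: leqW.
by exists m.+1; rewrite //= itm /= (negbTE vr).
Qed.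

Lemma chain_meet v w :
  meet_within chain k (Some (v, ord0)) (Some (w, ord0)) <->
  meet_within par k v w.
Proof.
split=> -[i [j [le_k itE]]].
  exists i, j; split=> //.
  have [|mi [iE _ _]] := @iter_chain i v; first by lia.
  have [|mj [jE _ _]] := @iter_chain j w; first by lia.
  by move: itE; rewrite iE jE => -[].
have [i1 le_i i1E] := iter_par_chain i v;
  have [j1 le_j j1E] := iter_par_chain j w.
by exists i1, j1; split; [lia | rewrite i1E j1E itE].
Qed.

(** The hypothesis on [par] lets p x be a root of the forest; its image is still a leaf, because its
    only neighbour is its image under [chain]. *)
Lemma forest_leaf_power (G : sgraph) (p : G -> V) (x0 : G) :
  injective p -> (forall v x, par v = p x -> v = p x) ->
  (forall x y, adj x y <-> x != y /\ meet_within par k (p x) (p y)) ->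
  is_leaf_power k G.
Proof.
move=> injp leafp adjE; have rootC := chain_rooted.
have [dep depC] := rooted_depth rootC.
have treeC := rooted_graph_tree rootC depC.
apply: (@leaf_power_prune k G (rooted_graph chain)
          (fun x => Some (p x, ord0)) x0 treeC).
- by move=> x y [/injp].
- move=> x; rewrite /is_leaf -(cards1 (chain (Some (p x, ord0)))).
  apply/subset_leq_card/subsetP => s; rewrite !inE => /andP[sx /orP[//|/eqP]].
  case: s sx => [[v i]|//] sx /=; case: ifP => [_|/negbT].
    by case: ifP => // lt_k [_ /(congr1 val)]; rewrite /= inordK.
  rewrite negb_or => /andP[_ vr] [pv].
  by rewrite -pv (leafp _ _ (esym pv)) eqxx in vr.
- move=> x y; apply/idP/andP => [/adjE[-> /chain_meet m]|[xy /path_withinP m]].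
    by split=> //; apply/path_withinP.
  by apply/adjE; split=> //; apply/chain_meet.
Qed.
End ForestToTree.

(** * Rooted presentation of leaf powers *)

Lemma leaf_power_inhabited (k : nat) (G : sgraph) :
  is_leaf_power k G -> inhabited G.
Proof.
case=> T [treeT [f [g fK gK] _]].
have [/card_gt0P[r _] _ _] := treeT.
have [par rootT adjT] := tree_rooting r treeT.
have [dep depT] := rooted_depth rootT.
have [x leafx] := rooted_exists_leaf rootT depT.
have leafx' : @is_leaf T x.
  apply: leq_trans leafx; apply/subset_leq_card/subsetP=> y.
  by rewrite !inE /= adjT.
by constructor; apply: (g (exist _ x leafx')).
Qed.

(** Rooting at an inner vertex leaves all leaves childless. If the tree has no inner vertex, any two
    of its vertices are adjacent, so G is complete and is presented by a star with new centre
    [None]; its leaves are at distance 2, which is at most k. *)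
Lemma leaf_power_rooted (k : nat) (G : sgraph) : 2 <= k -> is_leaf_power k G ->
  exists (S : finType) (par : S -> S) (r : S) (p : G -> S),
    [/\ rooted par r, injective p, forall x s, par s <> p x &
      forall x y, adj x y <-> x != y /\ meet_within par k (p x) (p y)].
Proof.
move=> k2 [T [treeT [f bijf adjf]]].
have injp : injective (val \o f) by apply: inj_comp val_inj (bij_inj bijf).
have adjE x y : adj x y = (x != y) && path_within k (val (f x)) (val (f y)).
  by rewrite -adjf /= /leaf_adj (inj_eq (bij_inj bijf)).
case: (pickP (fun r : T => ~~ is_leaf r)) => [r r_inner|all_leaf].
  have [par rootT adjT] := tree_rooting r treeT.
  have [dep depT] := rooted_depth rootT; have [parr _] := rootT.
  exists T, par, r, (val \o f); split=> // [x s sx|x y]; last first.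
    rewrite adjE; split=> [/andP[xy pxy]|[xy m]].
      by split=> //; apply/(tree_path_withinP _ _ _ adjT).
    by rewrite xy; apply/(tree_path_withinP _ _ _ adjT).
  have leafx : is_leaf (par s) by rewrite sx; apply: (valP (f x)).
  have par_neq u : u != r -> u != par u.
    by move=> /depT.2 du; apply/eqP => uE; move: du; rewrite -uE; lia.
  have sr : s != r by apply: contraNneq r_inner => sr; rewrite -parr -{1}sr.
  have psr : par s != r by apply: contraNneq r_inner => <-.
  have : #|[set s; par (par s)]| <= 1.
    apply: leq_trans leafx; apply/subset_leq_card/subsetP=> u.
    rewrite !inE adjT /rooted_adj.
    by case/orP=> /eqP->; rewrite ?par_neq ?eqxx ?orbT // eq_sym par_neq.
  rewrite cards2; suff -> : s != par (par s) by [].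
  by apply: contra_neq sr => /esym; apply: par_cycle2 rootT _ depT _.
have complete (x y : G) : x != y -> adj x y.
  move=> xy; rewrite adjE xy /=.
  have [_ conn _] := treeT.
  have fxy : val (f x) != val (f y) by rewrite (inj_eq injp).
  suff adjxy : adj (val (f x)) (val (f y)).
    have k1 : 1 < k.+1 by lia.
    apply/existsP; exists (Ordinal k1); apply/existsP; exists [tuple val (f y)].
    by rewrite /= adjxy eqxx inE fxy.
  have /connectP[q xq yE] := conn (val (f x)) (val (f y)).
  case/shortenP: xq yE => {}q xq uq _ yE.
  case: q xq uq yE => [|z [|t q]] /=; first by move=> _ _ /esym/eqP;
    rewrite (negbTE fxy).
    by move=> /andP[xz _] _ ->.
  move=> /and3P[xz zt _] /and3P[xzt _ _] _.
  have /negbFE leafz := all_leaf z.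
  have : #|[set val (f x); t]| <= 1.
    apply: leq_trans leafz; apply/subset_leq_card/subsetP=> u.
    by rewrite !inE => /orP[]/eqP-> //; rewrite adj_sym.
  rewrite cards2; suff -> : val (f x) != t by [].
  by apply: contraNneq xzt => ->; rewrite !inE eqxx orbT.
exists (option G), (fun=> None), None, Some; split=> // [|x y [] //|x y].
  by split=> // x; exists 1.
split=> [xy|[/complete]//]; split; last by exists 1, 1.
by apply: contraTneq xy => ->; rewrite adj_irr.
Qed.

(** * Embedding a leaf root into the product *)

Lemma connect_crossing (T : finType) (e : rel T) (P : pred T) (x y : T) :
  connect e x y -> P x -> ~~ P y ->
  exists u v, [/\ connect e x v, e u v, P u & ~~ P v].
Proof.
case/connectP=> q xq -> {y}; elim: q x xq => [|z q IH] x /=.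
  by move=> _ ->.
case/andP=> xz zq Px nPy; have [Pz|nPz] := boolP (P z).
  have [u [v [zv uv Pu nPv]]] := IH z zq Pz nPy.
  by exists u, v; split=> //; apply: connect_trans zv; apply: connect1.
by exists x, z; split=> //; apply: connect1.
Qed.

Section Embedding.
Variables (k : nat) (G : sgraph) (S : finType) (par : S -> S) (r : S).
Variables (p : G -> S) (dep : S -> nat).
Hypotheses (k_gt1 : 1 < k) (rootS : rooted par r).
Hypotheses (depS : depth_function par r dep) (injp : injective p).
Hypothesis childless : forall x s, par s <> p x.
Hypothesis adjE :
  forall x y, adj x y <-> x != y /\ meet_within par k (p x) (p y).

Let k_gt0 : 0 < k := ltnW k_gt1.

(** * Components of the leaves below a vertex, and their representatives *)

Definition below (a : G) (s : S) : bool := fconnect par (p a) s.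

Lemma belowP a s : below a s ->
  dep s <= dep (p a) /\ iter (dep (p a) - dep s) par (p a) = s.
Proof. by move/iter_findex/(iter_depE rootS depS). Qed.

Lemma below_par a s : below a s -> below a (par s).
Proof. by move=> a_below_s; apply: connect_trans a_below_s (fconnect1 _ _). Qed.

Lemma below_leaf a b : below b (p a) -> b = a.
Proof.
move/iter_findex; case: (findex _ _ _) => [/injp //|n] /=.
by move/childless.
Qed.

(** On the leaves below s, its connectivity classes are the components C that index the copies (s,
    C) of s. *)
Definition adj_below (s : S) : rel G :=
  fun a b => [&& below a s, below b s & adj a b].

Lemma connect_belowC s a b :
  connect (adj_below s) a b = connect (adj_below s) b a.
Proof.
apply: sym_connect_sym => x y.
by rewrite /adj_below adj_sym andbCA.
Qed.

Lemma connect_below s a b :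
  connect (adj_below s) a b -> below a s -> below b s.
Proof.
move=> ab a_below_s; apply/negPn/negP => nbs.
by have [u [v [_ /and3P[_ ->]]]] :=
  connect_crossing (P := below^~ s) ab a_below_s nbs.
Qed.

Lemma connect_below_par s a b :
  connect (adj_below s) a b -> connect (adj_below (par s)) a b.
Proof.
apply: connect_sub => x y /and3P[xs ys xy]; apply: connect1.
by rewrite /adj_below xy !below_par.
Qed.

(* Depth first; the rank of a only breaks ties, so that a representative of a
   component also represents every smaller component that contains it. *)
Definition weight (a : G) : nat := dep (p a) * #|G| + enum_rank a.

Lemma weight_inj : injective weight.
Proof.
move=> a b; rewrite /weight => wE; apply: enum_rank_inj; apply: val_inj.
move: (congr1 (modn^~ #|G|) wE); rewrite /= !modnMDl.
by rewrite !modn_small.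
Qed.

Lemma weight_le_dep a b : weight a <= weight b -> dep (p a) <= dep (p b).
Proof.
apply: contraTT; rewrite -!ltnNge /weight => lt_ba.
apply: (@leq_trans ((dep (p b)).+1 * #|G|)).
  by rewrite mulSn addnC ltn_add2r ltn_ord.
by apply: leq_trans (leq_addr _ _); rewrite leq_mul2r lt_ba orbT.
Qed.

Definition rep (s : S) (a : G) : G :=
  [arg min_(b < a | connect (adj_below s) a b) weight b].

Lemma connect_rep s a : connect (adj_below s) a (rep s a).
Proof. by rewrite /rep; case: arg_minnP => //; apply: connect0. Qed.

Lemma rep_min s a b : connect (adj_below s) a b -> weight (rep s a) <= weight b.
Proof.
by rewrite /rep; case: arg_minnP; [apply: connect0 | move=> c _; apply].
Qed.

Lemma rep_eq s a b : connect (adj_below s) a b -> rep s a = rep s b.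
Proof.
move=> ab; apply/weight_inj/eqP; rewrite eqn_leq !rep_min //.
  by apply: connect_trans (connect_rep s a); rewrite connect_belowC.
exact: connect_trans ab (connect_rep s b).
Qed.

Lemma rep_leaf a : rep (p a) a = a.
Proof.
apply: below_leaf; apply: connect_below (connect_rep _ _) _.
exact: connect0.
Qed.

(** * The forest in the product *)

Definition node (s : S) (a : G) : G * 'I_k :=
  (rep s a, Ordinal (ltn_pmod (dep s) k_gt0)).

(* The pair v = (a, c) stands for the ancestor place v of p a that lies height v
   above it and has depth c mod k; it encodes a split vertex only if that
   ancestor exists and a represents its component. *)
Definition height (v : G * 'I_k) : nat := (dep (p v.1) + (k - v.2)) %% k.

Definition place (v : G * 'I_k) : S := iter (height v) par (p v.1).

(** Pairs that encode no split vertex become roots, and so do those of height k - 1. Each remaining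
    edge then ends at a height below k, where the depth modulo k still determines the vertex of
    S. *)
Definition up (v : G * 'I_k) : G * 'I_k :=
  if [&& height v <= dep (p v.1), rep (place v) v.1 == v.1 & height v + 2 <= k]
  then node (par (place v)) v.1 else v.

Lemma height_node s a :
  below a s -> dep (p (rep s a)) - dep s < k ->
  height (node s a) = dep (p (rep s a)) - dep s.
Proof.
move=> a_below_s lt_k;
  have [le_d _] := belowP (connect_below (connect_rep s a) a_below_s).
rewrite /height /=; set D := dep (p _) in le_d lt_k *;
  set d := dep s in le_d lt_k *.
have d_lt := ltn_pmod d k_gt0; have dE := divn_eq d k.
have -> : D + (k - d %% k) = (d %/ k).+1 * k + (D - d) by lia.
by rewrite modnMDl modn_small.
Qed.

Lemma place_node s a :
  below a s -> dep (p (rep s a)) - dep s < k -> place (node s a) = s.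
Proof.
move=> a_below_s lt_k; rewrite /place height_node //=.
by have [] := belowP (connect_below (connect_rep s a) a_below_s).
Qed.

Lemma up_node s a :
  below a s -> dep (p (rep s a)) - dep s + 2 <= k ->
  up (node s a) = node (par s) a.
Proof.
move=> a_below_s lt_k; have lt_k1 : dep (p (rep s a)) - dep s < k by lia.
rewrite /up place_node // height_node //= leq_subr lt_k.
rewrite -(rep_eq (connect_rep s a)) eqxx /node.
by rewrite -(rep_eq (connect_below_par (connect_rep s a))).
Qed.

(** The component only grows on passing to the parent, so its representative gets no deeper and the
    height increases by at most one. *)
Lemma height_node_par s a :
  below a s -> dep (p (rep s a)) - dep s + 2 <= k ->
  dep (p (rep (par s) a)) - dep (par s) < k.
Proof.
move=> a_below_s lt_k;
  have /weight_le_dep := rep_min (connect_below_par (connect_rep s a)).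
by rewrite (dep_parE rootS depS); lia.
Qed.

(** Converse of [place_node]: a pair satisfying the first two tests of [up] does encode a split
    vertex. *)
Lemma node_place v :
  height v <= dep (p v.1) -> rep (place v) v.1 = v.1 ->
  [/\ below v.1 (place v), node (place v) v.1 = v &
      dep (p v.1) - dep (place v) = height v].
Proof.
case: v => a c /= le_h repE.
have dE : dep (place (a, c)) = dep (p a) - height (a, c).
  by rewrite /place (dep_iter rootS depS).
split; [exact: fconnect_iter | | by rewrite dE subKn].
rewrite /node repE; congr (_, _); apply: val_inj; rewrite /= dE.
move: le_h; rewrite /height /=; have := divn_eq (dep (p a) + (k - c)) k.
set h := _ %% k; set q := _ %/ k => qE le_h.
have c_lt := ltn_ord c.
rewrite -(modn_small c_lt) -(modnDr (dep (p a) - h)).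
have -> : dep (p a) - h + k = q * k + c by lia.
by rewrite modnMDl.
Qed.

Lemma upP v : up v != v ->
  [/\ node (place v) v.1 = v, below v.1 (place v), place v != r,
      dep (p v.1) - dep (place v) + 2 <= k &
      up v = node (par (place v)) v.1].
Proof.
rewrite /up; case: and3P => [[le_h /eqP repE lt_k] nv|]; last by rewrite eqxx.
have [below_v node_v h_v] := node_place le_h repE.
rewrite h_v; split=> //; apply: contraNneq nv => vr.
by rewrite vr rootS.1 -vr node_v.
Qed.

Lemma place_up v : up v != v -> place (up v) = par (place v).
Proof.
move=> nv; have [node_v below_v _ lt_k ->] := upP nv.
have repE : rep (place v) v.1 = v.1 := congr1 fst node_v.
apply: place_node; first exact: below_par.
by apply: height_node_par; rewrite ?repE.
Qed.

Lemma dep_place_up v :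
  up v != v -> dep (place v) = (dep (place (up v))).+1.
Proof.
by move=> nv; have [_ _ vr _ _] := upP nv; rewrite place_up // depS.2.
Qed.

(** * Parent edges are edges of the product *)

Lemma meet_crossing s a b : below a s -> below b (par s) -> ~~ below b s ->
  adj a b -> (dep (p a) - dep (par s)) + (dep (p b) - dep (par s)) <= k.
Proof.
move=> a_below_s bps nbs /adjE[_ [i [j [le_k itE]]]].
set t := iter i par (p a) in itE;
  have [le_t tE] := iter_depE rootS depS (erefl t).
have dt : dep t = dep (p a) - i := dep_iter rootS depS _ _.
have dt' : dep t = dep (p b) - j by rewrite itE (dep_iter rootS depS).
(* If the meeting point t were at least as deep as s, then s would be an ancestor of t and hence of
   b. *)
have lt_dt : dep t < dep s.
  rewrite ltnNge; apply: contra nbs => le_st.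
  have [le_sa sE] := belowP a_below_s.
  have <- : iter (dep t - dep s) par t = s.
    rewrite -{2}tE -iterD -{2}sE.
    by congr iter; lia.
  by rewrite itE -iterD; apply: fconnect_iter.
by rewrite (dep_parE rootS depS); lia.
Qed.

Lemma rep_par_adj s a : below a s ->
  rep s a = rep (par s) a \/ adj (rep s a) (rep (par s) a).
Proof.
move=> a_below_s; set a1 := rep s a; set a2 := rep (par s) a.
have aa1 : connect (adj_below s) a a1 := connect_rep s a.
have aa2 : connect (adj_below (par s)) a a2 := connect_rep (par s) a.
have [eq_a|neq_a] := eqVneq a1 a2; [by left | right].
have [aa2s|naa2] := boolP (connect (adj_below s) a a2).
  (* Each representative lies in the component of the other, so both have minimal weight and
     coincide. *)
  case/eqP: neq_a; apply/weight_inj/eqP; rewrite eqn_leq.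
  by rewrite !rep_min //; apply: connect_below_par.
have [u [v [av /and3P[ups vps uv] au nav]]] :=
  connect_crossing aa2 (connect0 (adj_below s) a) naa2.
have us : below u s := connect_below au a_below_s.
(* A vertex v below s would be joined to a through u, already below s. *)
have nvs : ~~ below v s.
  by apply: contra nav => vs; apply: connect_trans au (connect1 _); apply/and3P.
have le_k := meet_crossing us vps nvs uv.
have /weight_le_dep le1 : weight a1 <= weight u := rep_min au.
have /weight_le_dep le2 : weight a2 <= weight v := rep_min av.
have [_ it1] := belowP (below_par (connect_below aa1 a_below_s)).
have [_ it2] := belowP (connect_below aa2 (below_par a_below_s)).
apply/adjE; split=> //.
by exists (dep (p a1) - dep (par s)), (dep (p a2) - dep (par s)); split;
  [lia | rewrite it1 it2].
Qed.

Lemma up_adj v : up v != v -> @adj (strong_product G (cycle_graph k)) v (up v).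
Proof.
move=> nv; have [node_v below_v vr _ upE] := upP nv.
have repE : rep (place v) v.1 = v.1 := congr1 fst node_v.
rewrite /= /strong_adj eq_sym nv upE /=; apply/andP; split.
  by have := rep_par_adj below_v; rewrite repE => -[<-|->]; rewrite ?eqxx ?orbT.
rewrite -(congr1 snd node_v) /=.
set i := Ordinal _; set j := Ordinal _; have [//|ij] := eqVneq i j.
rewrite /= /cycle_adj ij orbC -val_eqE /= (depS.2 _ vr).
by rewrite -(addn1 (_ %% k)) modnDml addn1 eqxx.
Qed.

(** * Distances between the leaves of the forest *)

Definition leaf_node (a : G) : G * 'I_k := node (p a) a.

Lemma place_leaf a : place (leaf_node a) = p a.
Proof. by apply: place_node; rewrite ?rep_leaf ?subnn //; apply: connect0. Qed.

Lemma up_childless v a : up v = leaf_node a -> v = leaf_node a.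
Proof.
have [-> //|nv upE] := eqVneq (up v) v.
by have := place_up nv; rewrite upE place_leaf => /esym/childless.
Qed.

(** Steps of [up] that stay at a root are dropped, whence m may be smaller than n. So meeting in the
    forest implies meeting in S at no greater distance. *)
Lemma place_iter_up n v :
  exists2 m, m <= n & place (iter n up v) = iter m par (place v).
Proof.
elim: n => [|n [m le_m mE]]; first by exists 0.
have [/= ->|nv] := eqVneq (up (iter n up v)) (iter n up v).
  by exists m => //; apply: leqW.
by exists m.+1; rewrite //= place_up // mE.
Qed.

(** The representative is never deeper than a, so the height after n steps is at most n and the
    edges needed for fewer than k steps are all present. *)
Lemma iter_up_leaf n a :
  n < k -> iter n up (leaf_node a) = node (iter n par (p a)) a.
Proof.
elim: n => //= n IH lt_n; rewrite IH ?(ltnW lt_n) // up_node //.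
  exact: fconnect_iter.
have /weight_le_dep := rep_min (connect0 (adj_below (iter n par (p a))) a).
by rewrite (dep_iter rootS depS); lia.
Qed.

Lemma adj_up x y :
  adj x y <-> x != y /\ meet_within up k (leaf_node x) (leaf_node y).
Proof.
split=> [xy|[xy [i [j [le_k itE]]]]]; last first.
  apply/adjE; split=> //.
  have [i1 le_i i1E] := place_iter_up i (leaf_node x).
  have [j1 le_j j1E] := place_iter_up j (leaf_node y).
  exists i1, j1; split; first lia.
  by rewrite -!place_leaf -i1E -j1E itE.
have [nxy [i [j [le_k itE]]]] := (adjE x y).1 xy; split=> //.
(* Leaves are childless, so neither is an ancestor of the other. Both i and j are positive with sum
   at most k, hence both are below k, as [iter_up_leaf] requires. *)
have i_gt0 : 0 < i.
  case: i itE {le_k} => //; case: j => [/injp xE|j /= /esym/childless //].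
  by rewrite xE eqxx in nxy.
have j_gt0 : 0 < j.
  case: j itE {le_k} => //; case: i i_gt0 => // i _ /= /childless //.
exists i, j; split=> //; rewrite !iter_up_leaf; try lia.
rewrite itE /node; congr (_, _); apply: rep_eq; apply: connect1.
by rewrite /adj_below xy -{1}itE /below !fconnect_iter.
Qed.
End Embedding.

(** * The formula *)

Definition joined (Gr : sgraph) (F : {set edge Gr}) (x y : Gr) : bool :=
  (x != y) && [exists e in F, (x \in val e) && (y \in val e)].

Lemma edge_ends (Gr : sgraph) (e : edge Gr) (x y : Gr) :
  x != y -> x \in val e -> y \in val e -> adj x y /\ val e = [set x; y].
Proof.
have /imsetP[[a b] + eE] := valP e; rewrite inE eE /= => ab xy.
rewrite !inE => /orP[]/eqP xE /orP[]/eqP yE; move: xy;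
  rewrite xE yE ?eqxx // => _.
by rewrite adj_sym setUC.
Qed.

Lemma adj_edge (Gr : sgraph) (x y : Gr) : adj x y -> [set x; y] \in edges Gr.
Proof. by move=> xy; apply/imsetP; exists (x, y); rewrite ?inE. Qed.

Lemma joinedT (Gr : sgraph) (x y : Gr) : joined setT x y = adj x y.
Proof.
apply/andP/idP => [[xy /exists_inP[e _ /andP[xe ye]]]|xy].
  by have [] := edge_ends xy xe ye.
split; first by apply: contraTneq xy => ->; rewrite adj_irr.
apply/exists_inP; exists (Sub [set x; y] (adj_edge xy)); rewrite ?inE //.
by rewrite !eqxx orbT.
Qed.

(* An edge of F is oriented from the end in A_(c+1) to the end in A_c, with
   indices modulo 3. *)
Definition arc (Gr : sgraph) (F : {set edge Gr}) (A0 A1 A2 : {set Gr})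
    (x y : Gr) : bool :=
  joined F x y && [|| (x \in A1) && (y \in A0), (x \in A2) && (y \in A1) |
                      (x \in A0) && (y \in A2)].

(** The ends of a parent edge have consecutive levels, and 1 and -1 differ modulo 3, so the residues
    of [lev] determine its direction. *)
Lemma forest_arcs (Gr : sgraph) (par : Gr -> Gr) (lev : Gr -> nat) :
  (forall v, par v != v -> adj v (par v)) ->
  (forall v, par v != v -> lev v = (lev (par v)).+1) ->
  exists F A0 A1 A2, forall x y,
    arc F A0 A1 A2 x y = (par x != x) && (y == par x).
Proof.
move=> adjP levP; pose A c := [set v | lev v %% 3 == c].
exists [set e | [exists v, (par v != v) && (val e == [set v; par v])]].
exists (A 0), (A 1), (A 2) => x y; apply/idP/andP => [|[xp /eqP->]].
  case/andP=> /andP[xy /exists_inP[e]].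
  rewrite inE => /existsP[v /andP[vp /eqP eE]] /andP[xe ye].
  move: xe ye; rewrite eE !inE => /orP[]/eqP xE /orP[]/eqP yE.
  - by rewrite xE yE eqxx in xy.
  - by rewrite xE yE.
  - by subst x y; rewrite (levP v vp); lia.
  - by rewrite xE yE eqxx in xy.
rewrite /arc /joined eq_sym xp /=; apply/andP; split.
  apply/exists_inP; exists (Sub [set x; par x] (adj_edge (adjP x xp))).
    by rewrite inE; apply/existsP; exists x; rewrite xp eqxx.
  by rewrite /= !inE !eqxx orbT.
by rewrite !inE (levP x xp); lia.
Qed.

(** The recursion behind [mso_meet], where the fixed bound k is unrolled into the formula. The
    conditions that [par] moves its argument match [arc], which has no loops. *)
Lemma meet_withinS (V : eqType) (par : V -> V) (n : nat) (x y : V) :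
  meet_within par n.+1 x y <->
  [\/ meet_within par n x y, par x != x /\ meet_within par n (par x) y |
      par y != y /\ meet_within par n x (par y)].
Proof.
split=> [[[|i] [j [le_n itE]]]|].
- case: j le_n itE => [|j] le_n itE; first by constructor 1; exists 0, 0.
  have [yp|yp] := eqVneq (par y) y.
    by constructor 1; exists 0, j; split=> //; rewrite itE iterSr yp.
  by constructor 3; split=> //; exists 0, j; split=> //; rewrite itE iterSr.
- have [xp|xp] := eqVneq (par x) x.
    by constructor 1; exists i, j; split; [lia | rewrite -itE iterSr xp].
  by constructor 2; split=> //; exists i, j; split; [lia | rewrite -itE iterSr].
case=> [|[_]|[_]] [i [j [le_n itE]]].
- by exists i, j; split=> //; lia.
- by exists i.+1, j; split; [lia | rewrite iterSr].
- by exists i, j.+1; split; [lia | rewrite iterSr].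
Qed.

Definition v0 Gamma s : var (s :: Gamma) s := Var0 Gamma s.
Definition v1 Gamma s t : var (t :: s :: Gamma) s := VarS t (v0 Gamma s).
Definition v2 Gamma s t u : var (u :: t :: s :: Gamma) s :=
  VarS u (v1 Gamma s t).

Section Formulas.
Variable Gamma : seq mso_sort.
Implicit Types x y : var Gamma Vertex.

Definition mso_joined (F : var Gamma EdgeSet) x y : mso2 Gamma :=
  And (Not (Equal x y)) (@Exists Gamma Edge
    (And (MemE (v0 _ _) (VarS _ F))
      (And (Inc (v0 _ _) (VarS _ x)) (Inc (v0 _ _) (VarS _ y))))).

Definition mso_adj x y : mso2 Gamma :=
  And (Not (Equal x y)) (@Exists Gamma Edge
      (And (Inc (v0 _ _) (VarS _ x)) (Inc (v0 _ _) (VarS _ y)))).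
End Formulas.

Definition arc_vars (Gamma : seq mso_sort) : Type :=
  var Gamma EdgeSet *
  (var Gamma VertexSet * var Gamma VertexSet * var Gamma VertexSet).

Definition lift_arc Gamma s (a : arc_vars Gamma) : arc_vars (s :: Gamma) :=
  (VarS s a.1, (VarS s a.2.1.1, VarS s a.2.1.2, VarS s a.2.2)).

Definition mso_arc Gamma (a : arc_vars Gamma) (x y : var Gamma Vertex) :
    mso2 Gamma :=
  And (mso_joined a.1 x y)
    (Or (And (MemV x a.2.1.2) (MemV y a.2.1.1))
      (Or (And (MemV x a.2.2) (MemV y a.2.1.2))
          (And (MemV x a.2.1.1) (MemV y a.2.2)))).

Fixpoint mso_meet n Gamma (a : arc_vars Gamma) (x y : var Gamma Vertex) :
    mso2 Gamma :=
  if n is n'.+1 then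
    Or (mso_meet n' a x y)
      (Or (Exists (And (mso_arc (lift_arc Vertex a) (VarS _ x) (v0 _ _))
                       (mso_meet n' (lift_arc Vertex a) (v0 _ _) (VarS _ y))))
          (Exists (And (mso_arc (lift_arc Vertex a) (VarS _ y) (v0 _ _))
                       (mso_meet n' (lift_arc Vertex a) (VarS _ x) (v0 _ _)))))
  else Equal x y.

(* In a product with a connected graph, two vertices have the same first
   coordinate if and only if a path of horizontal edges connects them. *)
Definition mso_fiber Gamma (H : var Gamma EdgeSet) (x y : var Gamma Vertex) :
    mso2 Gamma :=
  @Forall Gamma VertexSet (Imp (MemV (VarS _ x) (v0 _ _))
    (Imp (@Forall _ Vertex (@Forall _ Vertex (Imp (MemV (v1 _ _ _) (v2 _ _ _ _))
           (Imp (mso_joined (VarS _ (VarS _ (VarS _ H))) (v1 _ _ _) (v0 _ _))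
                (MemV (v0 _ _) (v2 _ _ _ _))))))
         (MemV (VarS _ y) (v0 _ _)))).

Definition mso_fiber_adj Gamma (H : var Gamma EdgeSet)
    (x y : var Gamma Vertex) : mso2 Gamma :=
  @Exists Gamma Vertex (@Exists _ Vertex
    (And (mso_fiber (VarS _ (VarS _ H)) (VarS _ (VarS _ x)) (v1 _ _ _))
      (And (mso_fiber (VarS _ (VarS _ H)) (VarS _ (VarS _ y)) (v0 _ _))
           (mso_adj (v1 _ _ _) (v0 _ _))))).

(** From the innermost variable outwards: the leaves, the classes A2, A1, A0, the forest edges, the
    horizontal edges. *)
Definition leaf_vars : seq mso_sort :=
  [:: VertexSet; VertexSet; VertexSet; VertexSet; EdgeSet; EdgeSet].

Definition leaf_set : var leaf_vars VertexSet := v0 _ _.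

Definition leaf_arcs : arc_vars leaf_vars :=
  (VarS _ (VarS _ (VarS _ (v1 _ _ _))),
    (VarS _ (v2 _ _ _ _), v2 _ _ _ _, v1 _ _ _)).

Definition leaf_hor : var leaf_vars EdgeSet :=
  VarS _ (VarS _ (VarS _ (v2 _ _ _ _))).

Section LeafPowerFormula.
Variable k : nat.
Let a2 s t : arc_vars (t :: s :: leaf_vars) :=
  lift_arc t (lift_arc s leaf_arcs).
Let a3 s t u : arc_vars (u :: t :: s :: leaf_vars) := lift_arc u (a2 s t).
Let L2 s t : var (t :: s :: leaf_vars) VertexSet := VarS t (VarS s leaf_set).
Let H2 s t : var (t :: s :: leaf_vars) EdgeSet := VarS t (VarS s leaf_hor).

Definition mso_functional : mso2 leaf_vars :=
  @Forall _ Vertex (@Forall _ Vertex (@Forall _ Vertex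
    (Imp (mso_arc (a3 _ _ _) (v2 _ _ _ _) (v1 _ _ _))
      (Imp (mso_arc (a3 _ _ _) (v2 _ _ _ _) (v0 _ _))
           (Equal (v1 _ _ _) (v0 _ _)))))).

(** On a finite graph this excludes directed cycles; together with [mso_functional], every parent
    chain ends at a root. *)
Definition mso_well_founded : mso2 leaf_vars :=
  @Forall _ VertexSet (Imp (@Exists _ Vertex (MemV (v0 _ _) (v1 _ _ _)))
    (@Exists _ Vertex (And (MemV (v0 _ _) (v1 _ _ _))
      (@Forall _ Vertex (Imp (MemV (v0 _ _) (v2 _ _ _ _))
        (Not (mso_arc (a3 _ _ _) (v1 _ _ _) (v0 _ _)))))))).

Definition mso_childless : mso2 leaf_vars :=
  @Forall _ Vertex (@Forall _ Vertex
    (Imp (mso_arc (a2 _ _) (v1 _ _ _) (v0 _ _))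
         (Not (MemV (v0 _ _) (L2 _ _))))).

Definition mso_transversal : mso2 leaf_vars :=
  And (@Forall _ Vertex (@Exists _ Vertex
        (And (MemV (v0 _ _) (L2 _ _))
             (mso_fiber (H2 _ _) (v1 _ _ _) (v0 _ _)))))
      (@Forall _ Vertex (@Forall _ Vertex
        (Imp (MemV (v1 _ _ _) (L2 _ _)) (Imp (MemV (v0 _ _) (L2 _ _))
          (Imp (mso_fiber (H2 _ _) (v1 _ _ _) (v0 _ _))
               (Equal (v1 _ _ _) (v0 _ _))))))).

Definition mso_distances : mso2 leaf_vars :=
  @Forall _ Vertex (@Forall _ Vertex
    (Imp (MemV (v1 _ _ _) (L2 _ _)) (Imp (MemV (v0 _ _) (L2 _ _))
      (Imp (Not (Equal (v1 _ _ _) (v0 _ _)))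
        (And (Imp (mso_fiber_adj (H2 _ _) (v1 _ _ _) (v0 _ _))
                  (mso_meet k (a2 _ _) (v1 _ _ _) (v0 _ _)))
             (Imp (mso_meet k (a2 _ _) (v1 _ _ _) (v0 _ _))
                  (mso_fiber_adj (H2 _ _) (v1 _ _ _) (v0 _ _)))))))).

(** The first conjunct rules out the empty graph, which is no leaf power but satisfies the rest
    vacuously. *)
Definition mso_leaf_power : mso2 [:: EdgeSet] :=
  And (@Exists _ Vertex (Equal (v0 _ _) (v0 _ _)))
    (@Exists _ EdgeSet (@Exists _ VertexSet (@Exists _ VertexSet
      (@Exists _ VertexSet (@Exists _ VertexSet
        (And mso_functional (And mso_well_founded (And mso_childless
          (And mso_transversal mso_distances))))))))).
End LeafPowerFormula.

(** * Semantics of the formula *)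

Section Semantics.
Variables (Gr : sgraph) (Gamma : seq mso_sort).
Implicit Types (x y : var Gamma Vertex) (rho : env Gr Gamma).

Lemma sat_joined (F : var Gamma EdgeSet) x y rho :
  sat (mso_joined F x y) rho <->
  joined (lookup F rho : {set edge Gr}) (lookup x rho) (lookup y rho).
Proof.
split=> [[xy [e [eF [xe ye]]]]|/andP[/eqP xy /exists_inP[e eF /andP[xe ye]]]].
  by apply/andP; split; [apply/eqP | apply/exists_inP; exists e;
    last exact/andP].
by split=> //; exists e.
Qed.

Lemma sat_adj x y rho :
  sat (mso_adj x y) rho <-> adj (lookup x rho : Gr) (lookup y rho).
Proof.
rewrite -joinedT;
  split=> [[xy [e [xe ye]]]|/andP[/eqP xy /exists_inP[e _ /andP[xe ye]]]].
  apply/andP; split; first exact/eqP.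
  by apply/exists_inP; exists e; [rewrite inE | apply/andP].
by split=> //; exists e.
Qed.

Lemma sat_arc (a : arc_vars Gamma) x y rho :
  sat (mso_arc a x y) rho <->
  arc (lookup a.1 rho : {set edge Gr}) (lookup a.2.1.1 rho) (lookup a.2.1.2 rho)
    (lookup a.2.2 rho) (lookup x rho) (lookup y rho).
Proof.
split=> [[/sat_joined xy orient]|/andP[/sat_joined xy orient]].
  apply/andP; split=> //; apply/or3P.
  by case: orient => [[? ?]|[[? ?]|[? ?]]];
    [constructor 1 | constructor 2 | constructor 3]; apply/andP.
split=> //; case/or3P: orient => /andP[];
  by [left | right; left | right; right].
Qed.
End Semantics.

Lemma sat_meet (Gr : sgraph) (par : Gr -> Gr) n Gamma (a : arc_vars Gamma)
    (x y : var Gamma Vertex) (rho : env Gr Gamma) :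
  (forall u v : Gr, arc (lookup a.1 rho : {set edge Gr}) (lookup a.2.1.1 rho)
     (lookup a.2.1.2 rho) (lookup a.2.2 rho) u v =
     (par u != u) && (v == par u)) ->
  sat (mso_meet n a x y) rho <->
  meet_within par n (lookup x rho : Gr) (lookup y rho : Gr).
Proof.
elim: n Gamma a x y rho => [|n IH] Gamma a x y rho arcE.
  by split=> [/= ->|[[|i] [[|j] [// _ ?]]]] //; exists 0, 0.
rewrite meet_withinS; split=> [[|[]]|[]].
- by move/(IH _ _ _ _ _ arcE); constructor 1.
- case=> u [/sat_arc]; rewrite arcE => /andP[xp /eqP uE].
  by move/(IH (Vertex :: Gamma) (lift_arc _ a) _ _ (u, rho) arcE) => m;
    constructor 2; split=> //; rewrite -uE.
- case=> u [/sat_arc]; rewrite arcE => /andP[xp /eqP uE].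
  by move/(IH (Vertex :: Gamma) (lift_arc _ a) _ _ (u, rho) arcE) => m;
    constructor 3; split=> //; rewrite -uE.
- by move=> m; left; apply/IH.
- case=> xp m; right; left; exists (par (lookup x rho : Gr)); split.
    by apply/sat_arc; rewrite arcE xp eqxx.
  exact/(IH (Vertex :: Gamma) (lift_arc _ a) _ _ (_, rho) arcE).
- case=> yp m; right; right; exists (par (lookup y rho : Gr)); split.
    by apply/sat_arc; rewrite arcE yp eqxx.
  exact/(IH (Vertex :: Gamma) (lift_arc _ a) _ _ (_, rho) arcE).
Qed.

(** * Fibers of the product *)

Section Fibers.
Variables (k : nat) (G : sgraph).
Hypothesis k_gt1 : 1 < k.
Let P := strong_product G (cycle_graph k).
Let hor : {set edge P} := horizontal_edges G (cycle_graph k).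

Lemma joined_horizontal (u v : P) :
  joined hor u v = adj u v && (u.1 == v.1).
Proof.
apply/idP/andP => [/andP[uv /exists_inP[e]]|[uv uv1]].
  rewrite inE => /existsP[s /existsP[t /andP[/eqP eE /eqP st]]] /andP[ue ve].
  have [-> _] := edge_ends uv ue ve; split=> //.
  by move: ue ve; rewrite eE !inE => /orP[]/eqP-> /orP[]/eqP->; rewrite ?st.
apply/andP; split; first by apply: contraTneq uv => ->; rewrite adj_irr.
apply/exists_inP; exists (Sub [set u; v] (adj_edge uv)).
  by rewrite inE; apply/existsP; exists u; apply/existsP; exists v;
    rewrite /= eqxx.
by rewrite !SubK !inE !eqxx orbT.
Qed.

Lemma fiber_step (g : G) (i : 'I_k) :
  joined hor ((g, i) : P) ((g, ordS i) : P).
Proof.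
have iS : i != ordS i.
  apply/eqP => /(congr1 val) /=; have := ltn_ord i.
  by rewrite leq_eqVlt => /orP[/eqP ik|lt_k];
    [rewrite ik modnn | rewrite modn_small]; lia.
rewrite joined_horizontal /= /strong_adj /= eqxx /cycle_adj iS eqxx orbT.
by rewrite andbT xpair_eqE eqxx iS.
Qed.

Lemma sat_fiber Gamma (H : var Gamma EdgeSet) (x y : var Gamma Vertex)
    (rho : env P Gamma) : lookup H rho = hor ->
  sat (mso_fiber H x y) rho <-> (lookup x rho : P).1 = (lookup y rho : P).1.
Proof.
move=> HE; split=> [sat_xy|].
  pose X : {set P} := [set v | (lookup x rho : P).1 == v.1].
  have : (lookup y rho : P) \in X; last by rewrite inE => /eqP.
  apply: (sat_xy X) => [|u v uX /sat_joined]; first by rewrite /= inE.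
  move: uX; rewrite /= HE joined_horizontal !inE.
  by move=> /eqP-> /andP[].
move=> xy X xX closedX; change ((lookup y rho : P) \in (X : {set P})).
have {}xX : (lookup x rho : P) \in (X : {set P}) := xX.
case: (lookup x rho) (lookup y rho) xX xy => [g i] [_ j] iX /= <-.
have itX n : ((g, iter n (@ordS k) i) : P) \in (X : {set P}).
  elim: n => //= n IH; apply: closedX IH _; apply/sat_joined.
  by rewrite /= HE fiber_step.
have itE n : iter n (@ordS k) i = (i + n) %% k :> nat.
  elim: n => [|n IH] /=; first by rewrite addn0 modn_small.
  by rewrite IH -addn1 modnDml addn1 addnS.
(* Going forward k - i steps around the cycle reaches 0, and j more steps reach j. *)
have <- : iter (j + (k - i)) (@ordS k) i = j; last exact: itX.
apply: val_inj; rewrite /= itE; have := ltn_ord i => lt_i.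
have -> : i + (j + (k - i)) = j + k by lia.
by rewrite modnDr modn_small.
Qed.

Lemma sat_fiber_adj Gamma (H : var Gamma EdgeSet) (x y : var Gamma Vertex)
    (rho : env P Gamma) : lookup H rho = hor ->
  (lookup x rho : P).1 != (lookup y rho : P).1 ->
  sat (mso_fiber_adj H x y) rho <->
  adj (lookup x rho : P).1 (lookup y rho : P).1.
Proof.
move=> HE xy; split=> [[u [v [xu [yv /sat_adj uv]]]]|].
  have {}xu : (lookup x rho : P).1 = (u : P).1 by move/sat_fiber: xu; apply.
  have {}yv : (lookup y rho : P).1 = (v : P).1 by move/sat_fiber: yv; apply.
  move: uv; rewrite /= /strong_adj -xu -yv (negbTE xy).
  by case/and3P.
move=> adjxy; pose i : 'I_k := (lookup x rho : P).2.
(* An edge of G is witnessed between two fibers at a common second coordinate. *)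
exists ((lookup x rho : P).1, i), ((lookup y rho : P).1, i).
split; first exact/sat_fiber.
split; first exact/sat_fiber.
apply/sat_adj; rewrite /= /strong_adj /= eqxx adjxy orbT !andbT.
by apply: contra_neq xy => -[].
Qed.
End Fibers.

(** * The two directions of the equivalence *)

Lemma embedded_forest (k : nat) (G : sgraph) : 1 < k -> is_leaf_power k G ->
  let P := strong_product G (cycle_graph k) in
  exists (par : P -> P) (lev : P -> nat) (leaf : G -> P),
    [/\ (forall v, par v != v -> adj v (par v)) /\
        (forall v, par v != v -> lev v = (lev (par v)).+1),
      forall x, (leaf x).1 = x, forall v x, par v = leaf x -> v = leaf x &
      forall x y, adj x y <-> x != y /\ meet_within par k (leaf x) (leaf y)].
Proof.
move=> k_gt1 /(leaf_power_rooted k_gt1).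
move=> [S [par [r [p [rootS injp childless adjE]]]]].
have [dep depS] := rooted_depth rootS.
exists (up par p dep k_gt1), (fun v => dep (place par p dep v)).
exists (leaf_node par p dep k_gt1); split.
- split; first exact: up_adj rootS depS adjE.
  exact: dep_place_up rootS depS.
- by move=> x; apply: rep_leaf.
- exact: up_childless rootS depS injp childless.
- exact: adj_up rootS depS injp childless adjE.
Qed.

Lemma leaf_power_sat (k : nat) (G : sgraph) : 1 < k -> is_leaf_power k G ->
  @sat (strong_product G (cycle_graph k)) [:: EdgeSet] (mso_leaf_power k)
    (horizontal_edges G (cycle_graph k), tt).
Proof.
move=> k_gt1 lpG; have [x0] := leaf_power_inhabited lpG.
have [par [lev [leaf [[adjP levP] leaf1 childless adjE]]]] :=
  embedded_forest k_gt1 lpG.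
set P := strong_product G (cycle_graph k)
  in par lev leaf adjP levP leaf1 childless adjE *.
pose hor : {set edge P} := horizontal_edges G (cycle_graph k).
have [F [A0 [A1 [A2 arcE]]]] := forest_arcs adjP levP.
pose L : {set P} := [set leaf x | x in G].
have inL (y : P) : y \in L -> y = leaf y.1.
  by case/imsetP=> x _ ->; rewrite leaf1.
split; first by exists (leaf x0).
exists F, A0, A1, A2, L; split; [|split; [|split; [|split]]].
- move=> x y z /sat_arc + /sat_arc;
    rewrite !arcE => /andP[_ /eqP yE] /andP[_ /eqP zE].
  exact: etrans yE (esym zE).
- move=> X [x xX]; have {}xX : (x : P) \in (X : {set P}) := xX.
  (* A member of X of least level has no parent in X. *)
  case: (arg_minnP lev xX) => y yX ymin.
  exists y; split=> // z zX /sat_arc; rewrite arcE => /andP[/= yup /eqP zE].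
  by have := ymin z zX; rewrite zE (levP y yup) ltnn.
- move=> x y /sat_arc; rewrite arcE => /andP[/= xup /eqP yE] /inL yL.
  by case/eqP: xup; rewrite -yE yL; apply/esym/childless; rewrite -yE.
- split=> [x|x y /inL xL /inL yL xy].
    exists (leaf (x : P).1); split; first exact: imset_f.
    by apply/(sat_fiber k_gt1); rewrite //= leaf1.
  have {}xy : (x : P).1 = (y : P).1 by move/(sat_fiber k_gt1): xy; apply.
  by move: xL yL; rewrite /= xy => xL yL; apply: etrans xL (esym yL).
- move=> x y /inL xL /inL yL xy.
  have xy1 : (x : P).1 != (y : P).1.
    apply/eqP => xy1; apply: xy; move: xL yL; rewrite /= xy1.
    by move=> xL yL; apply: etrans xL (esym yL).
  have adjxy : @adj G (x : P).1 (y : P).1 <-> meet_within par k (x : P) (y : P).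
    move: xL yL; rewrite /= => xL yL.
    rewrite [X in meet_within _ _ X]xL [X in meet_within _ _ _ X]yL adjE xy1.
    by split=> [[]|].
  have meetE := @sat_meet P par k _ (lift_arc _ (lift_arc _ leaf_arcs))
    (v1 _ _ _) (v0 _ _) (y, (x, (L, (A2, (A1, (A0, (F, (hor, tt)))))))) arcE.
  split=> [/(sat_fiber_adj k_gt1) xyG|m]; first exact/meetE/adjxy/xyG.
  by apply/(sat_fiber_adj k_gt1)=> //; apply/adjxy/meetE.
Qed.

Lemma sat_leaf_power (k : nat) (G : sgraph) : 1 < k ->
  @sat (strong_product G (cycle_graph k)) [:: EdgeSet] (mso_leaf_power k)
    (horizontal_edges G (cycle_graph k), tt) ->
  is_leaf_power k G.
Proof.
set P := strong_product G (cycle_graph k).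
pose hor : {set edge P} := horizontal_edges G (cycle_graph k).
move=> k_gt1 [[x0 _] [F [A0 [A1 [A2 [L]]]]]].
case=> [func [wf [childless [[ex_leaf uniq_leaf] adjE]]]].
(* Vertices without an outgoing arc become roots, that is, fixed points. *)
pose par (v : P) : P := odflt v [pick w | arc F A0 A1 A2 v w].
have arc_neq (u : P) : arc F A0 A1 A2 u u = false by rewrite /arc /joined eqxx.
have arcE (u v : P) : arc F A0 A1 A2 u v = (par u != u) && (v == par u).
  rewrite /par; case: pickP => [w uw|no_arc] /=; last by rewrite eqxx no_arc.
  have -> : w != u by apply: contraTneq uw => ->; rewrite arc_neq.
  apply/idP/eqP => [uv|-> //].
  by apply: (func u v w); apply/sat_arc.
have k_gt0 : 0 < k := ltnW k_gt1.
have leafP (g : G) : exists v : P, (v \in (L : {set P})) && (v.1 == g).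
  have [v [vL /(sat_fiber k_gt1) gv]] := ex_leaf ((g, Ordinal k_gt0) : P).
  by exists v; apply/andP; split=> //; apply/eqP/esym/gv.
pose leaf g := xchoose (leafP g).
have leafL g : leaf g \in (L : {set P}) by case/andP: (xchooseP (leafP g)).
have leaf1 g : (leaf g).1 = g by case/andP: (xchooseP (leafP g)) => _ /eqP.
have inj_leaf : injective leaf by move=> g h /(congr1 fst); rewrite !leaf1.
apply: (@forest_leaf_power k P par _ G leaf (x0 : P).1 inj_leaf) =>
  [v|v g vg|g h].
(* The set of iterates of v is closed under [par], so a member with no arc into it is a root. *)
- pose X : {set P} := [set u | fconnect par v u].
  have [|u [uX stop]] := wf X; first by exists v; rewrite /= inE.
  have {}uX : fconnect par v u by rewrite inE in uX.
  exists (findex par v u); rewrite iter_findex //; apply/eqP/negPn/negP => uup.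
  apply: (stop (par u)); first by rewrite /= inE (connect_trans uX) ?fconnect1.
  by apply/sat_arc; rewrite arcE; apply/andP; split=> //=.
- have [<- //|vup] := eqVneq (par v) v.
  case: (childless v (leaf g)); last exact: leafL.
  by apply/sat_arc; rewrite arcE /= vup vg eqxx.
have [->|gh] := eqVneq g h; first by rewrite adj_irr; split=> // -[].
have leaf_neq : leaf g <> leaf h by move/inj_leaf => /eqP; rewrite (negbTE gh).
have [adj_meet meet_adj] := adjE (leaf g) (leaf h) (leafL g) (leafL h) leaf_neq.
have leaf_neq1 : (leaf g).1 != (leaf h).1 by rewrite !leaf1.
have meetE := @sat_meet P par k _ (lift_arc _ (lift_arc _ leaf_arcs))
  (v1 _ _ _) (v0 _ _)
  (leaf h, (leaf g, (L, (A2, (A1, (A0, (F, (hor, tt)))))))) arcE.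
split=> [adjgh|[_ m]].
  split=> //; apply/meetE/adj_meet/(sat_fiber_adj k_gt1) => //.
  by rewrite /= !leaf1.
move/meetE/meet_adj/(sat_fiber_adj k_gt1): m.
by rewrite /= !leaf1; apply.
Qed.

Theorem corollary6 (k : nat) (hk : 2 <= k) :
  exists phi : mso2 [:: EdgeSet],
  forall G : sgraph,
    is_leaf_power k G <->
    @sat (strong_product G (cycle_graph k)) [:: EdgeSet] phi
      (horizontal_edges G (cycle_graph k), tt).
Proof.
exists (mso_leaf_power k) => G; split; first exact: leaf_power_sat.
exact: sat_leaf_power.
Qed.
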